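(* Let $\mu>0$ be fixed. If $f\in BV([0,1])$, then for all $n\in\mathbb{N}$, $n\ge 1$, $$\Vert\mathscr{L}_n f\Vert_{BV_\mu}\le\Vert f\Vert_{BV_\mu}.$$
   Context: Fix a real parameter $\mu>0$. Put $\ln_\mu(x):=\ln(1+\mu+x)$ for $x\in[0,1]$, and for $n\in\mathbb{N}$, $n\ge 1$, and $0\le k\le n$ put $p_{n,k}(y):=\binom{n}{k}y^k(1-y)^{n-k}$ and $$a_n(x):=\frac{\ln\left(1+\frac{x}{n(1+\mu)}\right)}{\ln\left(1+\frac{1}{n(1+\mu)}\right)},\qquad x\in[0,1].$$ For a bounded function $f:[0,1]\to\mathbb{R}$, define $$\mathscr{L}_n f(x)=\mathscr{L}_n(f,x):=\ln_\mu(x)\sum_{k=0}^n \frac{f(k/n)}{\ln_\mu(k/n)}\,p_{n,k}(a_n(x)),\qquad x\in[0,1].$$ $BV([0,1])$ is the space of real functions of bounded (Jordan) variation on $[0,1]$. For $g:[0,1]\to\mathbb{R}$, $Var_{[0,1]}(g):=\sup\sum_{i=0}^{m-1}|g(x_{i+1})-g(x_i)|$, the supremum being over all partitions $0=x_0<x_1<\dots<x_m=1$. For $f\in BV([0,1])$, $$\Vert f\Vert_{BV_\mu}:=Var_{[0,1]}\left(\frac{f}{\ln_\mu}\right)+|f(0)|.$$ *)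

(* Defs.v *)
From HB Require Import structures.
From mathcomp Require Import all_boot all_order all_algebra.
From mathcomp Require Import all_classical all_reals all_analysis.

Set Implicit Arguments.
Unset Strict Implicit.
Unset Printing Implicit Defensive.

Import Order.TTheory GRing.Theory Num.Theory.

Local Open Scope ring_scope.

(* Functions on [0, 1] are represented by total functions R -> R; every
   definition below reads its function argument only at points of [0, 1]. *)

Definition ln_mu {R : realType} (mu x : R) : R := ln (1 + mu + x).

Definition bernstein {R : realType} (n k : nat) (y : R) : R :=
  'C(n, k)%:R * y ^+ k * (1 - y) ^+ (n - k).

Definition node_map {R : realType} (mu : R) (n : nat) (x : R) : R :=
  ln (1 + x / (n%:R * (1 + mu))) / ln (1 + 1 / (n%:R * (1 + mu))).

Definition Lop {R : realType} (mu : R) (n : nat) (f : R -> R) (x : R) : R :=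
  ln_mu mu x * \sum_(k < n.+1)
    f (k%:R / n%:R) / ln_mu mu (k%:R / n%:R) * bernstein n k (node_map mu n x).

(* Valued in \bar R, so that it is +oo exactly when f / ln_mu has unbounded
   variation on [0, 1]. *)
Definition BVmu_norm {R : realType} (mu : R) (f : R -> R) : \bar R :=
  (total_variation 0 1 (fun x => (f x / ln_mu mu x)%R) + `|f 0%R|%R%:E)%E.

(* Main.v *)
Require Import Defs.
From mathcomp Require Import all_boot all_order all_algebra.
From mathcomp Require Import all_classical all_reals all_analysis.
From mathcomp Require Import ring lra.

(** Dividing by [ln_mu], the operator becomes a Bernstein polynomial composed
    with the increasing map [node_map], so it suffices that Bernstein
    polynomials do not increase variation.  By Abel summation [B_n g] is
    [g 0] plus the sum of the jumps [g ((k+1)/n) - g (k/n)] weighted by the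
    binomial tails, i.e. the probabilities that a binomial variable of parameters
    [n], [y] is at least [k+1]; these tails are nondecreasing in [y] with values
    in [[0, 1]], so the variation is at most the sum of the absolute jumps. *)

Import Order.TTheory GRing.Theory Num.Theory.

Local Open Scope ring_scope.

(** By the triangle inequality the variation of [F] along a partition is at most the
    [|d k|]-weighted sum of the variations of the [h k]; monotonicity makes each of these telescope
    to [h k b - h k a]. *)
Lemma total_variation_mixture (R : realType) (a b : R) (n : nat) (F : R -> R)
    (c : R) (d : nat -> R) (h : nat -> R -> R) :
  {in `[a, b], F =1 fun x => c + \sum_(k < n) d k * h k x} ->
  (forall k, {in `[a, b] &, {homo h k : x y / x <= y}}) ->
  (forall k, h k b - h k a <= 1) ->
  (total_variation a b F <= (\sum_(k < n) `|d k|)%:E)%E.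
Proof.
move=> FE hnd h1; apply: ge_ereal_sup => _ [_ [s abs <-] <-].
rewrite lee_fin.
apply: (@le_trans _ _ (\sum_(k < n) `|d k| * variation a b (h k) s)); last first.
  apply: ler_sum => k _.
  by rewrite (nondecreasing_variation (hnd k) abs) ler_piMr.
rewrite /variation; under [leRHS]eq_bigr do rewrite mulr_sumr.
rewrite exchange_big/= !big_nat; apply: ler_sum => i /andP[_ si].
(* [FE] is available only on [[a, b]], so the partition points must be located there. *)
have nth_in j : (j < (size s).+1)%N -> nth b (a :: s) j \in `[a, b].
  move=> js; rewrite in_itv/= (itv_partition_nth_ge js abs).
  exact: itv_partition_nth_le js abs.
rewrite (FE (nth b s i)) ?(nth_in i.+1)// (FE (nth b (a :: s) i)); last first.
  by apply: nth_in; exact: ltnW.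
rewrite opprD addrACA subrr add0r -sumrB; apply: le_trans (ler_norm_sum _ _ _) _.
by apply: ler_sum => k _; rewrite -mulrBr normrM.
Qed.

Lemma sum_jumps_le_total_variation (R : realType) (g : R -> R) (u : nat -> R)
    (m : nat) : {homo u : i j / (i <= j)%N >-> i <= j} ->
  ((\sum_(k < m) `|g (u k.+1) - g (u k)|)%:E <= total_variation (u 0%N) (u m) g)%E.
Proof.
move=> u_nd; elim: m => [|m IHm]; first by rewrite big_ord0 total_variationxx.
rewrite big_ord_recr/= EFinD (total_variationD g (u_nd 0%N m _) (u_nd m m.+1 _))//.
by apply: leeD => //; apply: total_variation_ge; exact: u_nd.
Qed.

Lemma sum_by_parts (R : comRingType) (g t : nat -> R) (m : nat) :
  \sum_(k < m.+1) g k * (t k - t k.+1) =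
  g 0%N * t 0%N + \sum_(k < m) (g k.+1 - g k) * t k.+1 - g m * t m.+1.
Proof.
elim: m => [|m IHm]; first by rewrite big_ord_recr !big_ord0/=; ring.
by rewrite big_ord_recr/= IHm [in RHS]big_ord_recr/=; ring.
Qed.

(* The probability that a sum of [n] independent Bernoulli variables of
   parameter [y] is at least [k], computed by conditioning on the last one. *)
Fixpoint binomial_tail {R : realType} (n k : nat) (y : R) : R :=
  match n, k with
  | _, 0 => 1
  | 0, _.+1 => 0
  | n'.+1, k'.+1 =>
      (1 - y) * binomial_tail n' k'.+1 y + y * binomial_tail n' k' y
  end.

Section BinomialTail.
Context {R : realType}.
Implicit Types (n k : nat) (x y : R).

Lemma binomial_tail0 n y : binomial_tail n 0 y = 1.
Proof. by case: n. Qed.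

Lemma binomial_tail_oversize n k y : (n < k)%N -> binomial_tail n k y = 0.
Proof.
elim: n k => [|n IHn] [|k]//= nk.
by rewrite !IHn ?mulr0 ?addr0//; exact: ltnW.
Qed.

Lemma bernsteinS n k y :
  bernstein n.+1 k.+1 y = (1 - y) * bernstein n k.+1 y + y * bernstein n k y.
Proof.
rewrite /bernstein binS natrD subSS.
(* If [n <= k], the truncated exponent [n - k.+1] is wrong, but its coefficient ['C(n, k.+1)]
   vanishes. *)
have [kn|nk] := ltnP k n; last first.
  by rewrite (@bin_small n k.+1)// exprS; ring.
by rewrite -[(n - k)%N]prednK ?subn_gt0// -subnS !exprS; ring.
Qed.

(** Both sides obey the same recursion in [n], which for [bernstein] is Pascal's rule. *)
Lemma bernstein_tail n k y :
  bernstein n k y = binomial_tail n k y - binomial_tail n k.+1 y.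
Proof.
elim: n k => [|n IHn] [|k].
- by rewrite /bernstein bin0 !expr0/=; ring.
- by rewrite /bernstein bin0n/=; ring.
- transitivity ((1 - y) * bernstein n 0 y).
    by rewrite /bernstein !bin0 !subn0 exprS; ring.
  by rewrite IHn/= binomial_tail0; ring.
- by rewrite bernsteinS !IHn/=; ring.
Qed.

Lemma binomial_tail_bounds n k y : 0 <= y <= 1 ->
  0 <= binomial_tail n k.+1 y <= binomial_tail n k y /\ binomial_tail n k y <= 1.
Proof.
move=> /andP[y0 y1].
elim: n k => [|n IHn] [|k]/=; rewrite ?lexx ?ler01//; split.
- have [+ _] := IHn 0%N; rewrite !binomial_tail0 => /andP[t0 t1]; apply/andP; nra.
- by [].
- have [/andP[t1 t2] _] := IHn k; have [/andP[t3 t4] _] := IHn k.+1.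
  apply/andP; nra.
- have [/andP[t1 t2] t3] := IHn k; nra.
Qed.

Lemma binomial_tail_homo n k :
  {in `[0, 1] &, {homo @binomial_tail R n k : x y / x <= y}}.
Proof.
move=> x y; rewrite !in_itv/= => x01 y01 xy.
elim: n k => [|n IHn] [|k]//=.
have [/andP[_ t] _] := @binomial_tail_bounds n k x x01.
have := IHn k; have := IHn k.+1; case/andP: y01 => y0 y1; case/andP: x01 => x0 x1.
(* Written as [T k.+1 + y * (T k - T k.+1)], with [T] the tails for [n], the tail grows with the
   explicit [y] because [T k.+1 <= T k], and with the [T]'s by induction. *)
nra.
Qed.

End BinomialTail.

Section NodeMap.
Context {R : realType}.
Variables (mu : R) (n : nat).
Hypotheses (mu_gt0 : 0 < mu) (n_gt0 : (0 < n)%N).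

Let c_gt0 : 0 < n%:R * (1 + mu).
Proof. by rewrite mulr_gt0 ?ltr0n// addr_gt0. Qed.

Let denom_gt0 : 0 < ln (1 + 1 / (n%:R * (1 + mu))).
Proof. by rewrite ln_gt0// ltrDl divr_gt0. Qed.

Lemma node_map0 : node_map mu n 0 = 0.
Proof. by rewrite /node_map mul0r addr0 ln1 mul0r. Qed.

Lemma node_map1 : node_map mu n 1 = 1.
Proof. by rewrite /node_map divff// gt_eqF. Qed.

Lemma node_map_homo : {in `[0, 1] &, {homo node_map mu n : x y / x <= y}}.
Proof.
move=> x y; rewrite !in_itv/= => /andP[x0 _] /andP[y0 _] xy.
rewrite /node_map ler_pM2r ?invr_gt0// ler_ln ?lerD2l ?ler_pM2r ?invr_gt0//.
  by rewrite qualifE/= ltr_wpDr// divr_ge0// ltW.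
by rewrite qualifE/= ltr_wpDr// divr_ge0// ltW.
Qed.

Lemma node_map_itv : {in `[0, 1], forall x, node_map mu n x \in `[0, 1]}.
Proof.
move=> x x01; have [x0 x1] : 0 <= x /\ x <= 1 by apply/andP; rewrite in_itv in x01.
rewrite in_itv/= -{1}node_map0 -node_map1.
by rewrite !node_map_homo// in_itv/= ?lexx ?ler01.
Qed.

End NodeMap.

Lemma ln_mu_gt0 (R : realType) (mu x : R) : 0 < mu -> 0 <= x -> 0 < ln_mu mu x.
Proof. by move=> mu0 x0; rewrite ln_gt0// -addrA ltrDl ltr_wpDr. Qed.

(** Since [node_map] fixes 0, only the term [k = 0] survives there. *)
Lemma Lop0 (R : realType) (mu : R) (n : nat) (f : R -> R) :
  0 < mu -> Lop mu n f 0 = f 0.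
Proof.
move=> mu0; rewrite /Lop big_ord_recl/= big1 => [|k _].
  rewrite mul0r node_map0 /bernstein bin0 subr0 !expr1n !mulr1 addr0 mulrCA.
  by rewrite divff ?mulr1// gt_eqF// ln_mu_gt0.
by rewrite node_map0 /bernstein exprS mul0r mulr0 mul0r mulr0.
Qed.

Lemma Lop_div_ln_mu (R : realType) (mu : R) (n : nat) (f : R -> R) (x : R) :
  0 < mu -> 0 <= x ->
  let g k := f (k%:R / n%:R) / ln_mu mu (k%:R / n%:R) in
  Lop mu n f x / ln_mu mu x = g 0%N +
    \sum_(k < n) (g k.+1 - g k) * binomial_tail n k.+1 (node_map mu n x).
Proof.
move=> mu0 x0 g; rewrite /Lop mulrAC divff ?mul1r; last by rewrite gt_eqF// ln_mu_gt0.
under eq_bigr do rewrite bernstein_tail.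
rewrite (sum_by_parts _ g (fun k => binomial_tail n k (node_map mu n x))).
(* The boundary terms reduce to [g 0]: the tail is 1 at index 0 and 0 at index [n.+1]. *)
by rewrite binomial_tail0 mulr1 [X in _ - _ * X]binomial_tail_oversize// mulr0 subr0.
Qed.

Theorem theorem6p1 (R : realType) (mu : R) (hmu : 0 < mu)
    (f : R -> R) (hf : bounded_variation 0 1 f)
    (n : nat) (hn : (1 <= n)%N) :
  (BVmu_norm mu (Lop mu n f) <= BVmu_norm mu f)%E.
Proof.
rewrite /BVmu_norm Lop0//; apply: leeD => //.
pose q x := f x / ln_mu mu x; pose u k : R := k%:R / n%:R.
have u_nd : {homo u : i j / (i <= j)%N >-> i <= j}.
  by move=> i j ij; rewrite /u ler_pM2r ?ler_nat// invr_gt0 ltr0n.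
have u0 : u 0%N = 0 by rewrite /u mul0r.
have u1 : u n = 1 by rewrite /u divff// pnatr_eq0 -lt0n.
have := @sum_jumps_le_total_variation R q u n u_nd.
rewrite u1 u0; apply: le_trans.
apply: (@total_variation_mixture R 0 1 n _ (q (u 0%N))
  (fun k => q (u k.+1) - q (u k)) (fun k => binomial_tail n k.+1 \o node_map mu n)).
- by move=> x; rewrite in_itv/= => /andP[x0 _]; exact: Lop_div_ln_mu.
- move=> k x y x01 y01 xy /=.
  by apply: binomial_tail_homo; rewrite ?node_map_itv// node_map_homo.
- move=> k /=; rewrite node_map0 node_map1//.
  (* The tail is at most 1 at the right end and nonnegative at the left end, so its increment is at
     most 1. *)
  have [_ t1] := @binomial_tail_bounds R n k.+1 1 ltac:(lra).
  have [/andP[t0 _] _] := @binomial_tail_bounds R n k 0 ltac:(lra).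
  lra.
Qed.
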